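(* Let $\mu$ be a (possibly curved) $L_\infty$-structure on a graded vector space $E$, and let $\mathcal N$ be a Nijenhuis vector valued form with respect to $\mu$ with square $\mathcal K$. Put $\mu_0=\mu$ and $\mu_{k}=[\mathcal N,\mu_{k-1}]_{_{RN}}$ for $k\ge1$. Then: (i) for all integers $k\ge1$, $\mu_k$ is a (possibly curved) $L_\infty$-structure on $E$, and $\mathcal N$ is Nijenhuis with square $\mathcal K$ with respect to $\mu_k$; (ii) for all integers $k,l\ge1$, $[\mu_k,\mu_l]_{_{RN}}=0$.
   Context: Base field $\mathbb K=\mathbb R$ or $\mathbb C$; $E=\oplus_{i\in\mathbb Z}E_i$ graded vector space; $|X|$ is the degree of a homogeneous $X$. A symmetric vector valued $k$-form ($k\ge 0$) is a graded symmetric $k$-linear map $K:E\times\cdots\times E\to E$ (for $k=0$, an element of $E$). It has degree $\bar K$ if $|K(X_1,\dots,X_k)|=|X_1|+\cdots+|X_k|+\bar K$ (for $X\in E$, $\bar X=|X|$). A symmetric vector valued form is a formal sum $\sum_{k\ge0}K_k$ of vector valued $k$-forms; it has degree $d$ if all $K_k$ do. Insertion: for a $k$-form $K$ and an $l$-form $L$ with $l\ge1$, $$\iota_KL(X_1,\dots,X_{k+l-1})=\sum_{\sigma\in Sh(k,l-1)}\epsilon(\sigma)L(K(X_{\sigma(1)},\dots,X_{\sigma(k)}),X_{\sigma(k+1)},\dots,X_{\sigma(k+l-1)}),$$ where $Sh(k,l-1)$ is the set of $(k,l-1)$-unshuffles and $\epsilon(\sigma)$ is the Koszul sign ($X_{\sigma(1)}\cdots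 X_{\sigma(n)}=\epsilon(\sigma)X_1\cdots X_n$ in the graded symmetric algebra); $\iota_KL=0$ if $L\in E$; and $\iota_XK=K(X,\cdot,\dots,\cdot)$ for $X\in E$. Richardson-Nijenhuis bracket: $[K,L]_{_{RN}}=\iota_KL-(-1)^{\bar K\bar L}\iota_LK$, extended to formal sums. An $L_\infty$-structure is a sum $\mu=\sum_{i\ge1}l_i$ of symmetric vector valued $i$-forms $l_i$ of degree $1$ with $\sum_{i+j=n+1}\sum_{\sigma\in Sh(i,j-1)}\epsilon(\sigma)l_j(l_i(X_{\sigma(1)},\dots,X_{\sigma(i)}),\dots,X_{\sigma(n)})=0$ for all $n\ge1$. A curved $L_\infty$-structure is a sum $\mu=\sum_{i\ge0}l_i$ of such forms, with in addition $l_0\in E_1$ (the curvature, possibly zero), such that $l_1(l_0)=0$ and for all $n\geq 1$ one has $l_{n+1}(l_0,X_1,\dots,X_n)+\sum_{i+j=n+1,\,i,j\ge1}\sum_{\sigma\in Sh(i,j-1)}\epsilon(\sigma)l_j(l_i(X_{\sigma(1)},\dots,X_{\sigma(i)}),\dots,X_{\sigma(n)})=0$. ''Possibly curved'' means curved with $l_0$ allowed to be zero or not. For a symmetric vector valued form $\mu$ of degree $1$, a form $\mathcal N$ of degree zero is Nijenhuis with respect to $\mu$ with square $\mathcal K$ if $\mathcal K$ is a vector valued form of degree zero with $[\mathcal N,[\mathcal N,\mu]_{_{RN}}]_{_{RN}}=[\mathcal K,\mu]_{_{RN}}$ and $[\mathcal N,\mathcal K]_{_{RN}}=0$. *)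

(* Defs.v *)
From HB Require Import structures.
From mathcomp Require Import all_boot all_order all_algebra all_fingroup.
From mathcomp Require Import complex reals.

Set Implicit Arguments.
Unset Strict Implicit.
Unset Printing Implicit Defensive.

Import GRing.Theory.
Local Open Scope ring_scope.

Inductive base_field := RealNumbers | ComplexNumbers.

Definition scalars (R : realType) (b : base_field) : fieldType :=
  match b with
  | RealNumbers => (R : fieldType)
  | ComplexNumbers => (R[i] : fieldType)
  end.

(* E is the internal direct sum of the subspaces [homog G i], i : int. A finite
   sum of homogeneous vectors is given by the list of its terms, each one
   paired with its degree. *)
Record grading (F : fieldType) (E : lmodType F) := Grading {
  homog : int -> {pred E};
  homog_submod : forall i, submod_closed (homog i);
  homog_span : forall x : E, exists s : seq (int * E),
    all (fun t => t.2 \in homog t.1) s && (x == \sum_(t <- s) t.2);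
  homog_direct : forall s : seq (int * E),
    uniq (unzip1 s) -> all (fun t => t.2 \in homog t.1) s ->
    \sum_(t <- s) t.2 = 0 -> forall t, t \in s -> t.2 = 0
}.

Definition parity (d : int) : bool := odd `|d|%N.

(* A formal sum of maps K_k : E^k -> E, k >= 0, is a single function on finite
   sequences: K_k is its restriction to the sequences of size k. *)
Definition vform (F : fieldType) (E : lmodType F) := seq E -> E.

(* The sequence x_(s 0), ..., x_(s (n-1)). *)
Definition permute (T : Type) (x0 : T) (n : nat) (s : 'S_n) (xs : seq T) :
  seq T := [seq nth x0 xs (s i) | i : 'I_n].

(* x_(s 0) ... x_(s (n-1)) = koszul p s * x_0 ... x_(n-1) in the graded
   symmetric algebra, where p lists the parities of the degrees of the x_i:
   there is one sign (-1)^(|x||y|) for each pair put out of order by s. *)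
Definition koszul (F : fieldType) (p : seq bool) (n : nat) (s : 'S_n) : F :=
  \prod_(i < n) \prod_(j < n | (i < j)%N && (s j < s i)%N)
    (-1) ^+ (nth false p (s i) && nth false p (s j)).

(* s is a (k, n - k)-unshuffle. *)
Definition unshuffle (k n : nat) (s : 'S_n) : bool :=
  [forall i : 'I_n, forall j : 'I_n,
    ((i < j)%N && ((j < k)%N || (k <= i)%N)) ==> (s i < s j)%N].

Section Forms.
Variables (F : fieldType) (E : lmodType F) (G : grading E).
Implicit Types (K L mu N : vform E).

Definition homog_seq (ds : seq int) (xs : seq E) : bool :=
  all2 (fun d x => x \in homog G d) ds xs.

Definition multilinear K : Prop :=
  forall (s t : seq E) (a : F) (x y : E),
    K (s ++ (a *: x + y) :: t) = a *: K (s ++ x :: t) + K (s ++ y :: t).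

Definition graded_symmetric K : Prop :=
  forall (ds : seq int) (xs : seq E), homog_seq ds xs ->
  forall s : 'S_(size xs),
    K (permute 0 s xs) = koszul F (map parity ds) s *: K xs.

Definition has_degree (d : int) K : Prop :=
  forall (ds : seq int) (xs : seq E), homog_seq ds xs ->
    K xs \in homog G (\sum_(e <- ds) e + d).

Definition symform (d : int) K : Prop :=
  [/\ multilinear K, graded_symmetric K & has_degree d K].

(* The sum over s in Sh(k, n - k), n = size xs, of
   eps(s) L(K(x_(s 0), ..., x_(s (k-1))), x_(s k), ..., x_(s (n-1))),
   where p lists the parities of the x_i. *)
Definition unshuffle_sum (k : nat) (p : seq bool) K L (xs : seq E) : E :=
  \sum_(s : 'S_(size xs) | unshuffle k s)
    koszul F p s *:
      L (K (take k (permute 0 s xs)) :: drop k (permute 0 s xs)).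

Definition decomp (x : E) : seq (int * E) := xchoose (homog_span G x).

(* The even (b = false) or odd (b = true) component of x. *)
Definition parity_part (b : bool) (x : E) : E :=
  \sum_(t <- decomp x | parity t.1 == b) t.2.

Definition parity_parts (p : seq bool) (xs : seq E) : seq E :=
  [seq parity_part t.1 t.2 | t <- zip p xs].

(* The Koszul sign only makes sense on homogeneous arguments, and depends only
   on their parities: arbitrary arguments are split into their even and odd
   components. On homogeneous arguments only one p contributes, see
   [insertion_homog]. The component of arity n is the sum of the insertions of
   the k-form of K into the (n + 1 - k)-form of L, 0 <= k <= n; the 0-form of L
   does not contribute. *)
Definition insertion K L : vform E := fun xs =>
  \sum_(p : (size xs).-tuple bool) \sum_(k < (size xs).+1)
    unshuffle_sum k p K L (parity_parts p xs).

(* The bracket of a form K of degree dK and a form L of degree dL. *)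
Definition RN_bracket (dK dL : int) K L : vform E := fun xs =>
  insertion K L xs - ((-1) ^ (dK * dL) : F) *: insertion L K xs.

Definition curved_Linfty mu : Prop :=
  [/\ symform 1 mu,
      mu [:: mu [::]] = 0 &
      forall (ds : seq int) (xs : seq E), homog_seq ds xs ->
        (1 <= size xs)%N ->
        mu (mu [::] :: xs)
          + \sum_(1 <= i < (size xs).+1)
              unshuffle_sum i (map parity ds) mu mu xs = 0].

Definition nijenhuis mu N K : Prop :=
  [/\ symform 0 N, symform 0 K,
      RN_bracket 0 1 N (RN_bracket 0 1 N mu) =1 RN_bracket 0 1 K mu &
      RN_bracket 0 0 N K =1 (fun=> 0)].

Fixpoint hierarchy N mu (k : nat) : vform E :=
  if k is k'.+1 then RN_bracket 0 1 N (hierarchy N mu k') else mu.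

Lemma homog0 d : 0 \in homog G d.
Proof. by case: (homog_submod G d). Qed.

Lemma homogD d : {in homog G d &, forall x y, x + y \in homog G d}.
Proof.
by move=> x y hx hy; rewrite -[x]scale1r; apply: (homog_submod G d).2.
Qed.

Lemma homogN d : {in homog G d, forall x, - x \in homog G d}.
Proof.
move=> x hx; rewrite -[- x]addr0 -scaleN1r.
by apply: (homog_submod G d).2 => //; exact: homog0.
Qed.

Lemma homog_sum0 (s : seq (int * E)) (P : pred int) :
  all (fun t => t.2 \in homog G t.1) s -> \sum_(t <- s) t.2 = 0 ->
  \sum_(t <- s | P t.1) t.2 = 0.
Proof.
move=> hs s0.
pose D := undup (unzip1 s); pose c d := \sum_(t <- s | t.1 == d) t.2.
have split_sum (Q : pred int) :
  \sum_(t <- s | Q t.1) t.2 = \sum_(d <- D | Q d) c d.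
  rewrite (exchange_big_dep (fun t => Q t.1)) /=; last by move=> d t Qd /eqP->.
  rewrite big_seq_cond [RHS]big_seq_cond; apply: eq_bigr => t /andP[ts Qt].
  rewrite big_mkcond (bigD1_seq t.1) ?undup_uniq ?mem_undup ?map_f //= Qt eqxx.
  by rewrite big1 ?addr0 // => d; rewrite eq_sym andbC => /negPf->.
have c0 d : d \in D -> c d = 0.
  move=> dD; have sE : unzip1 [seq (e, c e) | e <- D] = D.
    by rewrite /unzip1 -map_comp map_id_in.
  apply: (@homog_direct _ _ G [seq (e, c e) | e <- D] _ _ _ (d, c d)).
  - by rewrite sE undup_uniq.
  - apply/allP => _ /mapP[e _ ->] /=; rewrite /c big_seq_cond.
    elim/big_ind: _ => [|x y|t /andP[/(allP hs) ht /eqP <-]] //.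
      exact: homog0.
    exact: homogD.
  - by rewrite big_map /= -(split_sum predT).
  - exact: map_f.
by rewrite split_sum big_seq_cond big1 // => d /andP[/c0].
Qed.

Lemma parity_part_sum (b : bool) (x : E) (s : seq (int * E)) :
  all (fun t => t.2 \in homog G t.1) s -> x = \sum_(t <- s) t.2 ->
  parity_part b x = \sum_(t <- s | parity t.1 == b) t.2.
Proof.
move=> hs xE; have /andP[hd /eqP dE] := xchooseP (homog_span G x).
apply/eqP; rewrite -subr_eq0; apply/eqP.
have := @homog_sum0 (decomp x ++ [seq (t.1, - t.2) | t <- s])
  (fun d => parity d == b).
rewrite !big_cat !big_map /= !sumrN; apply; last by rewrite -dE -xE subrr.
rewrite all_cat hd all_map; apply: sub_all hs => t /=; exact: homogN.
Qed.

Lemma parity_part_homog (b : bool) (d : int) (x : E) : x \in homog G d ->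
  parity_part b x = if parity d == b then x else 0.
Proof.
move=> hx; rewrite (@parity_part_sum b x [:: (d, x)]) /= ?hx //.
  by rewrite big_mkcond big_seq1.
by rewrite big_seq1.
Qed.

Lemma multilinear0 K (xs : seq E) : multilinear K -> 0 \in xs -> K xs = 0.
Proof.
move=> mK /splitPr[s t]; have := mK s t 1 0 0.
by rewrite !scale1r addr0 => /eqP; rewrite -subr_eq0 opprD addNKr oppr_eq0 => /eqP.
Qed.

Lemma mem_permute (n : nat) (s : 'S_n) (x : E) (xs : seq E) :
  size xs = n -> x \in xs -> x \in permute 0 s xs.
Proof.
move=> sz /(nthP 0)[j]; rewrite sz => ltjn <-.
apply/mapP; exists (s^-1%g (Ordinal ltjn)); first by rewrite mem_enum.
by rewrite permKV.
Qed.

Lemma unshuffle_sum0 k p K L (xs : seq E) :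
  multilinear K -> multilinear L -> 0 \in xs -> unshuffle_sum k p K L xs = 0.
Proof.
move=> mK mL xs0; rewrite /unshuffle_sum big1 // => s _.
have := mem_permute s erefl xs0.
rewrite -[X in _ \in X](cat_take_drop k) mem_cat => /orP[] h0.
  by rewrite (multilinear0 mK h0) (multilinear0 mL) ?scaler0 ?mem_head.
by rewrite (multilinear0 mL) ?scaler0 // inE h0 orbT.
Qed.

Lemma insertion_homog K L (ds : seq int) (xs : seq E) :
  multilinear K -> multilinear L -> homog_seq ds xs ->
  insertion K L xs =
  \sum_(k < (size xs).+1) unshuffle_sum k (map parity ds) K L xs.
Proof.
move=> mK mL; rewrite /homog_seq all2E => /andP[/eqP sz /allP h].
have szp : size (map parity ds) == size xs by rewrite size_map sz.
have hn i : (i < size xs)%N -> nth 0 xs i \in homog G (nth 0 ds i).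
  move=> lti; apply: (h (nth 0 ds i, nth 0 xs i)).
  by rewrite -nth_zip // mem_nth // size_zip sz minnn.
have szpp (p : (size xs).-tuple bool) : size (zip p xs) = size xs.
  by rewrite size_zip size_tuple minnn.
have pn (p : (size xs).-tuple bool) i : (i < size xs)%N ->
    nth 0 (parity_parts p xs) i =
    if parity (nth 0 ds i) == nth false p i then nth 0 xs i else 0.
  move=> lti; rewrite (nth_map (false, 0)) ?szpp //.
  by rewrite nth_zip ?size_tuple //= (parity_part_homog _ (hn i lti)).
rewrite /insertion (bigD1 (Tuple szp)) //= [X in _ + X]big1 ?addr0.
  apply: eq_bigr => k _; congr unshuffle_sum.
  apply: (@eq_from_nth _ 0); rewrite size_map (szpp (Tuple szp)) // => i lti.
  by rewrite (pn (Tuple szp)) //= (nth_map 0) ?sz // eqxx.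
move=> p neq_p; apply: big1 => k _; apply: unshuffle_sum0 => //.
have [i lti neq_i] : exists2 i, (i < size xs)%N &
    parity (nth 0 ds i) != nth false p i.
  have [/existsP[i hi]|] := boolP [exists i : 'I_(size xs),
      parity (nth 0 ds i) != nth false p i]; first by exists i.
  rewrite negb_exists => /forallP heq; case/eqP: neq_p; apply: val_inj => /=.
  apply: (@eq_from_nth _ false); rewrite size_tuple ?size_map ?sz // => i lti.
  by rewrite (nth_map 0) ?sz //; apply/esym/eqP; have := heq (Ordinal lti); rewrite negbK.
apply/(nthP 0); exists i; first by rewrite size_map szpp.
by rewrite pn // (negPf neq_i).
Qed.

End Forms.

(* Main.v *)
Require Import Defs.
From mathcomp Require Import all_boot all_order all_algebra all_fingroup.
From mathcomp Require Import zify.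
From mathcomp Require Import complex reals boolp.

(** On homogeneous arguments the insertion i_K L is L o (K . id) o D,
    with D the unshuffle coproduct of the graded symmetric algebra.
    Coassociativity and cocommutativity of D make it a graded pre-Lie product:
    the part of i_K (i_L M) in which K and L act on disjoint sets of arguments
    is graded symmetric in K and L.  Hence [P, -] is a derivation of the bracket
    for P of degree 0, and mu is a curved structure iff [mu, mu] = 0.

    Since N and K commute, mu_(k+2) = [K, mu_k] for all k.  Put
    a(k,l) = [mu_k, mu_l] = a(l,k), and suppose a vanishes for k + l < n.
    Applying N to k + l = n - 1 gives a(k,l) = (-1)^k a(0,n) for k + l = n.
    If n is odd, symmetry gives a(0,n) = - a(0,n); if n >= 2 is even, applying K
    to a(0,n-2) = 0 gives a(2,n-2) + a(0,n) = 0, that is 2 a(0,n) = 0. *)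

Set Implicit Arguments.
Unset Strict Implicit.
Unset Printing Implicit Defensive.

Import GRing.Theory.
Local Open Scope ring_scope.

(** * Parities of degrees and the resulting signs *)

Lemma parityD (a b : int) : parity (a + b) = parity a (+) parity b.
Proof. rewrite /parity; lia. Qed.

Lemma signz_mul (F : fieldType) (a b : int) :
  (-1) ^ (a * b) = (-1) ^+ (parity a && parity b) :> F.
Proof.
have signz (d : int) : (-1) ^ d = (-1) ^+ parity d :> F.
  rewrite -[RHS]signr_odd oddb signr_odd; case: d => n //.
  by rewrite /exprz -exprVn invrN invr1.
by rewrite signz /parity abszM oddM.
Qed.

(** * The unshuffle coproduct: linearity, coassociativity, cocommutativity *)

Section Unshuffles.
Variables (F : fieldType) (V : lmodType F).

(* The sum of the terms eps f(l, r) over all ways of unshuffling s into two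
   subsequences l and r: the coproduct of s composed with f. *)
Fixpoint unsh (T : Type) (par : T -> bool) (f : seq T -> seq T -> V)
    (s : seq T) : V :=
  if s is x :: s' then
    unsh par (fun l r => f (x :: l) r) s'
    + unsh par (fun l r =>
        (-1) ^+ (par x && odd (count par l)) *: f l (x :: r)) s'
  else f [::] [::].

Lemma unsh_map (T U : Type) (h : T -> U) (par : U -> bool) f (s : seq T) :
  unsh par f (map h s)
  = unsh (par \o h) (fun l r => f (map h l) (map h r)) s.
Proof.
elim: s f => //= x s IH f; rewrite !IH; congr (_ + unsh _ _ _).
by apply/funext => l; apply/funext => r; rewrite count_map.
Qed.

Section EqType.
Variables (T : eqType) (par : T -> bool).
Implicit Types (f g : seq T -> seq T -> V) (s : seq T).

Lemma eq_unsh f g s :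
  (forall l r, perm_eq (l ++ r) s -> f l r = g l r) ->
  unsh par f s = unsh par g s.
Proof.
elim: s f g => [|x s IH] f g fg /=; first exact: fg.
congr (_ + _); apply: IH => l r lr; rewrite fg //= ?perm_cons //.
by rewrite -cat1s perm_catCA /= perm_cons.
Qed.

Lemma unshD f g s :
  unsh par (fun l r => f l r + g l r) s = unsh par f s + unsh par g s.
Proof.
elim: s f g => [|x s IH] f g //=; rewrite IH addrACA -IH; congr (_ + _).
by rewrite -IH; apply: eq_unsh => l r _; rewrite scalerDr.
Qed.

Lemma unshZ a f s : unsh par (fun l r => a *: f l r) s = a *: unsh par f s.
Proof.
elim: s f => [|x s IH] f //=; rewrite IH scalerDr -!IH; congr (_ + _).
by apply: eq_unsh => l r _; rewrite !scalerA mulrC.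
Qed.

Lemma unsh_sum (I : Type) (rI : seq I) (P : pred I)
    (f : I -> seq T -> seq T -> V) s :
  unsh par (fun l r => \sum_(i <- rI | P i) f i l r) s
  = \sum_(i <- rI | P i) unsh par (f i) s.
Proof.
elim: s f => [|x s IH] f //=; rewrite big_split /= -!IH; congr (_ + _).
by apply: eq_unsh => l r _; rewrite scaler_sumr.
Qed.

(** Coassociativity: on both sides the first letter goes to [a], [b] or [c], and its sign for
    passing [a] and [b] is the product of the signs for passing each. *)
Lemma unshA (f : seq T -> seq T -> seq T -> V) s :
  unsh par (fun l c => unsh par (fun a b => f a b c) l) s
  = unsh par (fun a r => unsh par (fun b c => f a b c) r) s.
Proof.
elim: s f => [|x s IH] f //=.
rewrite unshD -addrA; congr (_ + _).
  by rewrite (IH (fun a b c => f (x :: a) b c)).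
rewrite (IH (fun a b c => (-1) ^+ (par x && odd (count par a)) *: f a (x :: b) c)).
(* The sign depends on [l] only through its odd letters, hence on [a ++ b]; written this way the
   integrand no longer mentions [l] and the induction hypothesis applies. *)
rewrite [X in _ + X](_ : _ = unsh par (fun l c => unsh par (fun a b =>
   (-1) ^+ (par x && odd (count par (a ++ b))) *: f a b (x :: c)) l) s); last first.
  apply: eq_unsh => l r _; rewrite -unshZ; apply: eq_unsh => a b ab.
  by rewrite (seq.permP ab).
rewrite (IH (fun a b c => (-1) ^+ (par x && odd (count par (a ++ b))) *: f a b (x :: c))).
rewrite -unshD; apply: eq_unsh => a r _; rewrite scalerDr -!unshZ; congr (_ + _).
apply: eq_unsh => b c _; rewrite scalerA -signr_addb count_cat oddD.
by rewrite andb_addr.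
Qed.

(** Graded cocommutativity: sending the first letter to the other half changes the sign of
    exchanging the halves by exactly the sign in the recursion of [unsh]. *)
Lemma unshC f s :
  unsh par f s
  = unsh par (fun l r =>
      (-1) ^+ (odd (count par l) && odd (count par r)) *: f r l) s.
Proof.
elim: s f => [|x s IH] f /=; first by rewrite scale1r.
rewrite addrC; congr (_ + _).
  rewrite IH; apply: eq_unsh => l r _; rewrite scalerA -signr_addb oddD oddb.
  by case: (par x); case: odd; case: odd.
rewrite IH; apply: eq_unsh => l r _; rewrite scalerA -signr_addb oddD oddb.
by case: (par x); case: odd; case: odd.
Qed.

End EqType.
End Unshuffles.

(** * Koszul signs of index words and the enumeration of splittings *)

Section Splittings.
Variables (F : fieldType) (par : nat -> bool).

(** The Koszul sign of a permutation written as a word, in a recursive form that matches the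
    recursion of [unsh]. *)
Fixpoint inversion_sign (l : seq nat) : F :=
  if l is a :: l' then
    (-1) ^+ count (fun b => (b < a)%N && (par a && par b)) l'
    * inversion_sign l'
  else 1.

Lemma prod_sign (T : Type) (P Q : pred T) (l : seq T) :
  \prod_(x <- l | P x) (-1) ^+ Q x = (-1) ^+ count (predI P Q) l :> F.
Proof.
elim: l => [|x l IH]; first by rewrite big_nil.
by rewrite big_cons IH /=; case: (P x); rewrite //= exprD.
Qed.

Lemma prod_inversion_sign (n : nat) (g : 'I_n -> nat) :
  \prod_(i < n) \prod_(j < n | (i < j)%N && (g j < g i)%N)
    (-1) ^+ (par (g i) && par (g j))
  = inversion_sign [seq g i | i <- enum 'I_n].
Proof.
elim: n g => [|n IH] g; first by rewrite big_ord0 enum_ord0.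
rewrite big_ord_recl enum_ordSl /= -map_comp -(IH (g \o lift ord0)).
congr (_ * _).
  rewrite big_mkcond big_ord_recl /= mul1r -big_mkcond /=.
  by rewrite prod_sign count_map enumT.
apply: eq_bigr => i _; rewrite big_mkcond big_ord_recl /= mul1r -big_mkcond.
by apply: eq_bigl => j.
Qed.

(** A minimal letter is inverted only with the letters before it. The factor is the sign that [unsh]
    gives to a letter sent to the right half. *)
Lemma inversion_sign_min (x : nat) (l r : seq nat) :
  all (ltn x) l -> all (ltn x) r ->
  inversion_sign (l ++ x :: r)
  = (-1) ^+ (par x && odd (count par l)) * inversion_sign (l ++ r).
Proof.
move=> + xr; elim: l => [_|a l IH] /=.
  rewrite andbF (@eq_in_count _ _ pred0) ?count_pred0 // => b /(allP xr) /= xb.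
  by rewrite ltnNge ltnW.
case/andP=> xa /IH ->; rewrite !mulrA -!exprD !count_cat /= xa /=; congr (_ * _).
rewrite -[LHS]signr_odd -[RHS]signr_odd !oddD !oddb.
by case: (par x); case: (par a); do 3 case: odd.
Qed.

Fixpoint splits (s : seq nat) : seq (seq nat * seq nat) :=
  if s is x :: s' then
    [seq (x :: t.1, t.2) | t <- splits s']
    ++ [seq (t.1, x :: t.2) | t <- splits s']
  else [:: ([::], [::])].

(** The head of a strictly increasing list is its minimum, so it must head whichever increasing half
    contains it; removing it gives the induction. *)
Lemma mem_splits (s : seq nat) t : sorted ltn s ->
  (t \in splits s)
  = [&& sorted ltn t.1, sorted ltn t.2 & perm_eq (t.1 ++ t.2) s].
Proof.
have sort_cons x l : sorted ltn (x :: l) = all (ltn x) l && sorted ltn l.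
  exact: (path_sortedE ltn_trans).
elim: s t => [|x s IH] [l r].
  move=> _; rewrite inE; apply/idP/and3P => [/eqP[-> ->] //|[_ _ /perm_nilP/=]].
  by case: l => //= ->.
rewrite sort_cons => /andP[xs ss] /=; rewrite mem_cat; apply/idP/idP.
  case/orP => /mapP[[a b]]; rewrite IH // => /and3P[/= sa sb ab] [-> ->].
    rewrite sort_cons sa sb -!(perm_all _ ab) in xs *.
    by move: xs; rewrite all_cat => /andP[-> _]; rewrite /= perm_cons.
  rewrite sort_cons sa sb.
  move: xs; rewrite -(perm_all _ ab) all_cat => /andP[_ ->].
  by rewrite -cat1s perm_catCA /= perm_cons.
case/and3P => sl sr lr.
have le_x y : y \in l ++ r -> (x <= y)%N.
  by rewrite (perm_mem lr) inE => /predU1P[->//|/(allP xs)/ltnW].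
have := mem_head x s; rewrite -(perm_mem lr) mem_cat => /orP[xl|xr]; apply/orP.
  left; case: l => [//|y l] in sl lr le_x xl *.
  have /eqP yx: y == x.
    rewrite eqn_leq le_x ?mem_head // andbT.
    move: xl; rewrite inE => /predU1P[->//|xl].
    by move: sl; rewrite sort_cons => /andP[/allP/(_ _ xl)/= /ltnW].
  move: sl lr; rewrite yx sort_cons /= perm_cons => /andP[_ sl] lr.
  by apply/mapP; exists (l, r); rewrite ?IH //= sl sr.
right; case: r => [//|y r] in sr lr le_x xr *.
have /eqP yx: y == x.
  rewrite eqn_leq le_x ?mem_cat ?mem_head ?orbT // andbT.
  move: xr; rewrite inE => /predU1P[->//|xr].
  by move: sr; rewrite sort_cons => /andP[/allP/(_ _ xr)/= /ltnW].
move: sr lr; rewrite yx sort_cons -cat1s perm_catCA /= perm_cons =>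
  /andP[_ sr] lr.
by apply/mapP; exists (l, r); rewrite ?IH //= sl sr.
Qed.

Lemma splits_uniq (s : seq nat) : sorted ltn s -> uniq (splits s).
Proof.
elim: s => //= x s IH xs; have ss := path_sorted xs.
rewrite cat_uniq !map_inj_uniq ?IH //=; last 2 first.
- by move=> [a b] [c d] [-> ->].
- by move=> [a b] [c d] [-> ->].
rewrite andbT; apply/hasPn => t /mapP[[l r]]; rewrite mem_splits //.
case/and3P=> /= _ _ lr -> /=; apply/mapP => -[[l' r']] _ [lE _].
have: x \in s by rewrite -(perm_mem lr) lE mem_head.
by move/(allP (order_path_min ltn_trans xs)); rewrite ltnn.
Qed.

Variable V : lmodType F.

Lemma unsh_splits (f : seq nat -> seq nat -> V) (s : seq nat) : sorted ltn s ->
  unsh par f s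
  = \sum_(t <- splits s) inversion_sign (t.1 ++ t.2) *: f t.1 t.2.
Proof.
elim: s f => [|x s IH] f xs /=; first by rewrite big_seq1 scale1r.
have ss := path_sorted xs; have {}xs := order_path_min ltn_trans xs.
rewrite big_cat !big_map !IH //=; congr (_ + _); rewrite !big_seq;
  apply: eq_bigr => -[l r]; rewrite mem_splits // => /and3P[/= _ _ lr];
  move: xs; rewrite -(perm_all _ lr).
  move=> xlr; rewrite (@eq_in_count _ _ pred0) ?count_pred0 ?mul1r //.
  by move=> b /(allP xlr) /= xb; rewrite ltnNge ltnW.
by rewrite all_cat => /andP[xl xr]; rewrite inversion_sign_min // scalerA mulrC.
Qed.

End Splittings.

(** * From permutations to index words, and unshuffle sums as coproducts *)

Lemma koszul_inversion_sign (F : fieldType) (p : seq bool) n (s : 'S_n) :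
  koszul F p s = inversion_sign F (nth false p) [seq val (s i) | i : 'I_n].
Proof. by rewrite -prod_inversion_sign. Qed.

Lemma nth_perm_index n (s : 'S_n) (i : 'I_n) :
  nth 0%N [seq val (s i) | i : 'I_n] i = s i.
Proof. by rewrite (nth_map i) ?size_enum_ord // nth_ord_enum. Qed.

Lemma perm_index_iota n (s : 'S_n) :
  perm_eq [seq val (s i) | i : 'I_n] (iota 0 n).
Proof.
apply: uniq_perm; rewrite ?iota_uniq //.
  by rewrite map_inj_uniq ?enum_uniq // => i j /val_inj/perm_inj.
move=> x; rewrite mem_iota add0n /=; apply/mapP/idP => [[i _ ->] //|xn].
by exists (s^-1%g (Ordinal xn)); rewrite ?mem_enum ?permKV.
Qed.

Lemma perm_index_exists n (l : seq nat) : perm_eq l (iota 0 n) ->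
  exists s : 'S_n, [seq val (s i) | i : 'I_n] = l.
Proof.
move=> ln; have sl : size l = n by rewrite (perm_size ln) size_iota.
have lt_n (i : 'I_n) : (nth 0%N l i < n)%N.
  have: nth 0%N l i \in l by rewrite mem_nth // sl.
  by rewrite (perm_mem ln) mem_iota.
have inj_g : injective (fun i => Ordinal (lt_n i)).
  move=> i j /(congr1 val) /= /eqP.
  rewrite nth_uniq ?sl // => [/eqP/val_inj //|].
  by rewrite (perm_uniq ln) iota_uniq.
exists (perm inj_g).
apply: (@eq_from_nth _ 0%N); rewrite size_image card_ord ?sl // => i ni.
by rewrite (nth_perm_index _ (Ordinal ni)) permE.
Qed.

Lemma permute_map (T : Type) (x0 : T) n (s : 'S_n) (xs : seq T) :
  permute x0 s xs = map (nth x0 xs) [seq val (s i) | i : 'I_n].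
Proof. by rewrite /permute /image_mem -map_comp. Qed.

(** The pairs of positions compared by [unshuffle] are those on the same side of [k], and for a
    transitive order pairwise comparison is sortedness. *)
Lemma unshuffle_sorted k n (s : 'S_n) : (k <= n)%N ->
  let l := [seq val (s i) | i : 'I_n] in
  unshuffle k s = sorted ltn (take k l) && sorted ltn (drop k l).
Proof.
move=> kn l.
have sl : size l = n by rewrite size_image card_ord.
have nl (i : 'I_n) : nth 0%N l i = s i by rewrite nth_perm_index.
rewrite !(sorted_pairwise ltn_trans).
apply/idP/andP => [/forallP us|[/(pairwiseP 0%N) st /(pairwiseP 0%N) sd]].
  split; apply/(pairwiseP 0%N) => i j; rewrite !inE ?size_takel ?size_drop ?sl //.
    move=> ik jk ij; rewrite !nth_take //.
    have [ni nj] : (i < n)%N /\ (j < n)%N by lia.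
    have /forallP/(_ (Ordinal nj)) := us (Ordinal ni).
    by rewrite ij jk -!nl.
  move=> ik jk ij; rewrite !nth_drop.
  have [ni nj] : (k + i < n)%N /\ (k + j < n)%N by lia.
  have /forallP/(_ (Ordinal nj)) := us (Ordinal ni).
  by rewrite -!nl /= ltn_add2l ij leq_addr orbT.
apply/forallP => i; apply/forallP => j; apply/implyP => /andP[ij /orP[jk|ki]].
  rewrite -!nl; have := st i j; rewrite !inE size_takel ?sl // !nth_take //; last lia.
  by apply; lia.
have := sd (i - k)%N (j - k)%N; rewrite !inE size_drop sl !nth_drop !subnKC //;
  last lia.
by rewrite !nl; apply; have := ltn_ord j; lia.
Qed.

(* The Koszul sign of an unshuffle depends only on the resulting list of
   indices, and [splits (iota 0 n)] enumerates these lists, cut at k. *)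
Lemma unshuffle_sum_unsh (F : fieldType) (E : lmodType F) k p
    (K L : vform E) xs :
  (k <= size xs)%N -> size p = size xs ->
  unshuffle_sum k p K L xs
  = unsh fst (fun l r =>
      if size l == k then L (K (map snd l) :: map snd r) else 0) (zip p xs).
Proof.
set n := size xs => kn sp.
(* Passing to indices makes the letters distinct and increasing, so that splittings are not repeated
   even when arguments coincide. *)
have zE : zip p xs = map (fun i => (nth false p i, nth 0 xs i)) (iota 0 n).
  apply: (@eq_from_nth _ (false, 0)) => [|i].
    by rewrite size_map size_iota size_zip sp minnn.
  rewrite size_zip sp minnn => ni.
  by rewrite nth_zip // (nth_map 0%N) ?size_iota // nth_iota.
rewrite zE unsh_map unsh_splits; last exact: iota_ltn_sorted.
pose idx (s : 'S_n) := [seq val (s i) | i : 'I_n].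
have size_idx s : size (idx s) = n by rewrite size_image card_ord.
pose H t := inversion_sign F (nth false p) (t.1 ++ t.2)
  *: L (K (map (nth 0 xs) t.1) :: map (nth 0 xs) t.2) : E.
transitivity (\sum_(t <- splits (iota 0 n) | size t.1 == k) H t); last first.
  rewrite big_mkcond; apply: eq_bigr => -[l r] _ /=; rewrite size_map.
  by case: ifP; rewrite ?scaler0 // -!map_comp.
transitivity (\sum_(s : 'S_n | unshuffle k s) H (take k (idx s), drop k (idx s))).
  apply: eq_bigr => s _; rewrite /H /= cat_take_drop -koszul_inversion_sign.
  by rewrite permute_map map_take map_drop.
rewrite -big_filter -[RHS]big_filter -(big_map _ predT H).
apply: perm_big; apply: uniq_perm.
- rewrite map_inj_uniq ?filter_uniq ?index_enum_uniq // => s u [Et Ed].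
  have su : idx s = idx u.
    by rewrite -(cat_take_drop k (idx s)) Et Ed cat_take_drop.
  apply/permP => i; apply: val_inj.
  have: nth 0%N (idx s) i = nth 0%N (idx u) i by rewrite su.
  by rewrite !nth_perm_index.
- by rewrite filter_uniq // splits_uniq // iota_ltn_sorted.
move=> [l r]; rewrite mem_filter mem_splits ?iota_ltn_sorted //=.
apply/mapP/and4P => [[s]|[/eqP sl sol sor lr]].
  rewrite mem_filter unshuffle_sorted // => /andP[/andP[st sd] _] [-> ->].
  by split; rewrite ?size_takel ?size_idx ?cat_take_drop ?perm_index_iota.
have [s sE] := perm_index_exists lr.
exists s; last by rewrite /idx sE -sl take_size_cat // drop_size_cat.
rewrite mem_filter mem_index_enum unshuffle_sorted // sE -sl.
by rewrite take_size_cat // drop_size_cat // sol sor.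
Qed.

(** * Graded symmetry through adjacent transpositions *)

Section Swaps.
Variables (F : fieldType) (V : lmodType F) (T : eqType) (par : T -> bool).

Definition swap_symmetric (K : seq T -> V) : Prop :=
  forall u v x y,
    K (u ++ x :: y :: v) = (-1) ^+ (par x && par y) *: K (u ++ y :: x :: v).

Lemma swap_symmetric_move K u w v x : swap_symmetric K ->
  K (u ++ x :: w ++ v)
  = (-1) ^+ (par x && odd (count par w)) *: K (u ++ w ++ x :: v).
Proof.
move=> sK; elim: w u => [|y w IH] u /=; first by rewrite andbF scale1r.
rewrite sK -cat_rcons IH cat_rcons scalerA -signr_addb oddD oddb.
by rewrite andb_addr.
Qed.

(** Insertion sort: the tail is sorted by induction, then the head [a] moves past the smaller
    letters [s1], which costs the head factor of [inversion_sign]. *)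
Lemma swap_symmetric_sort K (f : nat -> T) u (l s : seq nat) :
  swap_symmetric K -> sorted ltn s -> perm_eq l s ->
  K (u ++ map f l) = inversion_sign F (par \o f) l *: K (u ++ map f s).
Proof.
move=> sK; elim: l u s => [|a l IH] u s ss ls.
  by move: ls; rewrite perm_sym => /perm_nilP ->; rewrite scale1r.
have sa : a \in s by rewrite -(perm_mem ls) mem_head.
case/path.splitPr: s / sa => s1 s2 in ss ls *.
have {ls} ls : perm_eq l (s1 ++ s2).
  by move: ls; rewrite -[a :: s2]cat1s perm_sym perm_catCA perm_cons perm_sym.
have := ss; rewrite (sorted_pairwise ltn_trans) pairwise_cat /=.
case/and3P=> a12 p1 /andP[a2 p2].
have /allP s1a : all (gtn a) s1.
  by apply/allP => b b1; have /allP/(_ _ b1)/andP[] := a12.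
have s12 : sorted ltn (s1 ++ s2).
  rewrite (sorted_pairwise ltn_trans) pairwise_cat p1 p2 !andbT.
  by apply/allP => b b1; have /allP/(_ _ b1)/andP[] := a12.
rewrite -cat_rcons (IH _ _ s12 ls) cat_rcons !map_cat.
rewrite (swap_symmetric_move _ _ _ _ sK).
rewrite scalerA mulrC /= (seq.permP ls) count_cat; congr (_ * _ *: _).
rewrite -[RHS]signr_odd oddD.
rewrite (@eq_in_count _ _ (fun b => par (f a) && par (f b)) s1); last first.
  by move=> b /s1a /= ->.
rewrite (@eq_in_count _ _ pred0 s2) ?count_pred0 ?addbF; last first.
  by move=> b /(allP a2) /= ab; rewrite ltnNge ltnW.
rewrite count_map; case: (par (f a)) => /=; first by [].
by rewrite (@eq_count _ _ pred0) // count_pred0.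
Qed.

(** If [x] and [y] fall in the same half, the symmetry of [f] there applies; if they fall in
    different halves, the two placements are exchanged with the sign of the coproduct itself. *)
Lemma unsh_swap_symmetric (f : seq T -> seq T -> V) :
  (forall r, swap_symmetric (fun l => f l r)) ->
  (forall l, swap_symmetric (f l)) -> swap_symmetric (unsh par f).
Proof.
move=> fl fr u v x y; elim: u f fl fr => [|z u IH] f fl fr /=.
  rewrite !scalerDr -!unshZ [X in _ = X]addrACA; congr (_ + _ + (_ + _));
    congr unsh; apply/funext => l; apply/funext => r.
  - exact: (fl r [::]).
  - by rewrite !scalerA -!signr_addb /= ?oddD ?oddb;
      case: (par x); case: (par y); case: odd.
  - by rewrite !scalerA -!signr_addb /= ?oddD ?oddb;
      case: (par x); case: (par y); case: odd.
  - by rewrite (fr l [::]) !scalerA -!signr_addb /=;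
      case: (par x); case: (par y); case: odd.
rewrite scalerDr; congr (_ + _).
  exact: (IH _ (fun r a => fl r (z :: a))).
apply: IH => [r|l] a b c d.
- by rewrite fl !scalerA mulrC !count_cat /= (addnCA (par c)).
- by rewrite (fr l (z :: a)) !scalerA mulrC.
Qed.

End Swaps.

Lemma inversion_sign_cat (F : fieldType) par (u l : seq nat) :
  sorted ltn u -> (forall a b, a \in u -> b \in l -> (a < b)%N) ->
  inversion_sign F par (u ++ l) = inversion_sign F par l.
Proof.
elim: u => //= a u IH au ul; rewrite IH ?(path_sorted au) //; last first.
  by move=> c b cu; apply: ul; rewrite inE cu orbT.
rewrite (@eq_in_count _ _ pred0) ?count_pred0 ?mul1r // => b; rewrite mem_cat.
have lt_a := allP (order_path_min ltn_trans au).
by case/orP => [/lt_a|/(ul _ _ (mem_head _ _))] /= ab; rewrite ltnNge ltnW.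
Qed.

(** * Insertion as a coproduct, and its multilinearity *)

Section Insertion.
Variables (F : fieldType) (E : lmodType F) (G : grading E).
Implicit Types (K L M : vform E).

(** Summing over [k] lifts the constraint on the left half: each splitting occurs for exactly one
    [k], the size of [l]. *)
Lemma sum_unshuffle_sum p K L (xs : seq E) : size p = size xs ->
  \sum_(k < (size xs).+1) unshuffle_sum k p K L xs
  = unsh fst (fun l r => L (K (map snd l) :: map snd r)) (zip p xs).
Proof.
move=> sp; rewrite (eq_bigr (fun k : 'I_(size xs).+1 => unsh fst (fun l r =>
  if size l == k then L (K (map snd l) :: map snd r) else 0) (zip p xs))).
  rewrite -unsh_sum; apply: eq_unsh => l r /perm_size.
  rewrite size_cat size_zip sp minnn => lr.
  have lt_l : (size l < (size xs).+1)%N by rewrite ltnS -lr leq_addr.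
  rewrite (bigD1 (Ordinal lt_l)) //= eqxx big1 ?addr0 // => i.
  by rewrite -val_eqE /= eq_sym => /negPf ->.
by move=> k _; apply: unshuffle_sum_unsh => //; rewrite -ltnS.
Qed.

(** The arity is a separate variable so that insertions evaluated at different lists of one length
    become sums over the same type of tuples. *)
Lemma insertionE n K L (xs : seq E) : size xs = n ->
  insertion G K L xs = \sum_(p : n.-tuple bool)
    unsh fst (fun l r => L (K (map snd l) :: map snd r))
      (zip p (parity_parts G p xs)).
Proof.
move=> <-; apply: eq_bigr => p _.
have sp : size (parity_parts G p xs) = size xs.
  by rewrite size_map size_zip size_tuple minnn.
by rewrite -(@sum_unshuffle_sum p K L) sp ?size_tuple.
Qed.

(** [L - a M] is the shape of the bracket; this and [insertionBl] expand nested brackets. *)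
Lemma insertionBr a K L M (xs : seq E) :
  insertion G K (fun ys => L ys - a *: M ys) xs
  = insertion G K L xs - a *: insertion G K M xs.
Proof.
rewrite !(@insertionE (size xs)) // scaler_sumr -sumrB; apply: eq_bigr => p _.
rewrite -scaleNr -unshZ addrC -unshD; apply: eq_unsh => l r _.
by rewrite scaleNr addrC.
Qed.

Lemma multilinear_head a x y (xs : seq E) K : multilinear K ->
  K (a *: x + y :: xs) = a *: K (x :: xs) + K (y :: xs).
Proof. by move=> mK; apply: (mK [::]). Qed.

Lemma insertionBl a K L M (xs : seq E) : multilinear M ->
  insertion G (fun ys => K ys - a *: L ys) M xs
  = insertion G K M xs - a *: insertion G L M xs.
Proof.
move=> mM.
rewrite !(@insertionE (size xs)) // scaler_sumr -sumrB; apply: eq_bigr => p _.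
rewrite -scaleNr -unshZ addrC -unshD; apply: eq_unsh => l r _.
by rewrite addrC -scaleNr multilinear_head.
Qed.

Lemma homogZ d a x : x \in homog G d -> a *: x \in homog G d.
Proof.
by move=> hx; rewrite -[_ *: _]addr0; apply: (homog_submod G d).2;
  rewrite ?homog0.
Qed.

(** The decomposition chosen by [decomp] need not be linear, but any homogeneous decomposition
    computes [parity_part], in particular a scaled one followed by another. *)
Lemma parity_part_linear b a (x y : E) :
  parity_part G b (a *: x + y) = a *: parity_part G b x + parity_part G b y.
Proof.
have decompP z : all (fun t => t.2 \in homog G t.1) (decomp G z)
    /\ z = \sum_(t <- decomp G z) t.2.
  by have /andP[hz /eqP] := xchooseP (homog_span G z).
have [[hx xE] [hy yE]] := (decompP x, decompP y).
rewrite (@parity_part_sum _ _ _ b _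
  ([seq (t.1, a *: t.2) | t <- decomp G x] ++ decomp G y)).
- by rewrite big_cat big_map /= scaler_sumr.
- rewrite all_cat hy andbT all_map; apply: sub_all hx => t /=.
  exact: homogZ.
- by rewrite big_cat big_map /= -scaler_sumr -xE -yE.
Qed.

(** The varying letter carries the same parity [b] in all three terms, so the signs agree. *)
Lemma unsh_linear (f : seq (bool * E) -> seq (bool * E) -> E) u v b a
    (x y : E) :
  (forall u v r, f (u ++ (b, a *: x + y) :: v) r
    = a *: f (u ++ (b, x) :: v) r + f (u ++ (b, y) :: v) r) ->
  (forall l u v, f l (u ++ (b, a *: x + y) :: v)
    = a *: f l (u ++ (b, x) :: v) + f l (u ++ (b, y) :: v)) ->
  unsh fst f (u ++ (b, a *: x + y) :: v)
  = a *: unsh fst f (u ++ (b, x) :: v) + unsh fst f (u ++ (b, y) :: v).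
Proof.
elim: u f => [|z u IH] f fl fr /=.
  rewrite scalerDr addrACA; congr (_ + _); rewrite -unshZ -unshD;
    apply: eq_unsh => l r _; first exact: (fl [::]).
  by rewrite (fr l [::]) scalerDr !scalerA mulrC.
rewrite scalerDr addrACA; congr (_ + _); apply: IH => [s t r|l s t].
- exact: (fl (z :: s)).
- exact: fr.
- by rewrite !count_cat /= fl scalerDr !scalerA mulrC.
- by rewrite (fr l (z :: s)) scalerDr !scalerA mulrC.
Qed.

Lemma multilinear_insertion K L :
  multilinear K -> multilinear L -> multilinear (insertion G K L).
Proof.
move=> mK mL s t a x y; set n := (size s + (size t).+1)%N.
rewrite !(@insertionE n) ?size_cat // scaler_sumr -big_split; apply: eq_bigr => p _.
have sn : (size s < size p)%N by rewrite size_tuple /n addnS ltnS leq_addr.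
have pE := cat_take_drop (size s) p; rewrite (drop_nth false sn) in pE.
have sp : size (take (size s) p) = size s by rewrite size_takel // ltnW.
set q := nth _ _ _ in pE; set p1 := take _ _ in pE sp; set p2 := drop _ _ in pE.
(* For a fixed [p] the varying argument enters only through its component of parity [q], which is
   linear in it. *)
have zE z : zip p (parity_parts G p (s ++ z :: t))
    = zip p1 (parity_parts G p1 s) ++ (q, parity_part G q z)
      :: zip p2 (parity_parts G p2 t).
  rewrite -pE /parity_parts zip_cat // map_cat zip_cat //.
  by rewrite size_map size_zip sp minnn.
rewrite !zE parity_part_linear unsh_linear // => [u v r|l u v].
  by rewrite !map_cat /= mK multilinear_head.
by rewrite !map_cat /=; exact: (mL (_ :: _)).
Qed.

Lemma multilinearB a K L : multilinear K -> multilinear L ->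
  multilinear (fun xs => K xs - a *: L xs).
Proof.
move=> mK mL s t c x y; rewrite mK mL scalerBr !scalerDr !scalerA mulrC.
by rewrite opprD addrACA.
Qed.

End Insertion.

Lemma map_nth_swap (T : Type) (x0 : T) (u v : seq T) x y :
  map (nth x0 (u ++ y :: x :: v))
    (iota 0 (size u) ++ (size u).+1 :: size u :: iota (size u).+2 (size v))
  = u ++ x :: y :: v.
Proof.
rewrite map_cat map_nth_iota0 ?size_cat ?leq_addr // take_size_cat //=.
rewrite !nth_cat !ltnNge leqnn leqnSn /= subSnn subnn /=; congr (_ ++ _ :: _ :: _).
rewrite map_nth_iota; last by rewrite size_cat /=; lia.
rewrite drop_cat.
by rewrite ltnNge -addn2 leq_addr /= addKn /= drop0 take_size.
Qed.

(** This is the word of an adjacent transposition; its only inversion is the pair [m.+1], [m]. *)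
Lemma inversion_sign_swap (F : fieldType) (par : nat -> bool) m k :
  inversion_sign F par (iota 0 m ++ m.+1 :: m :: iota m.+2 k)
  = (-1) ^+ (par m.+1 && par m).
Proof.
have no_inversion (P : pred nat) a b : (a <= b)%N ->
    count (fun i => (i < a)%N && P i) (iota b k) = 0%N.
  move=> ab; rewrite (@eq_in_count _ _ pred0) ?count_pred0 // => i.
  by rewrite mem_iota /= => ?; lia.
rewrite inversion_sign_cat ?iota_ltn_sorted //; last first.
  by move=> a b; rewrite mem_iota !inE mem_iota; lia.
rewrite /= ltnSn /= !no_inversion //; last by lia.
rewrite expr0 mul1r addn0.
rewrite -[iota _ _]cats0 inversion_sign_cat ?iota_ltn_sorted //.
by rewrite mulr1.
Qed.

(** * Reduction to homogeneous arguments *)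

Section Homogeneous.
Variables (F : fieldType) (E : lmodType F) (G : grading E).
Implicit Types (K L M N : vform E).

(* Homogeneous vectors carry their degree, since 0 has all degrees. *)
Definition hvec := {t : int * E | t.2 \in homog G t.1}.
Definition hdeg (h : hvec) : int := (val h).1.
Definition hval (h : hvec) : E := (val h).2.
Definition hpar (h : hvec) : bool := parity (hdeg h).
Definition sdeg (s : seq hvec) : int := \sum_(h <- s) hdeg h.

Lemma homog_seq_hom (s : seq hvec) : homog_seq G (map hdeg s) (map hval s).
Proof. by elim: s => //= h s ->; rewrite andbT; exact: (valP h). Qed.

Lemma homog_seqP ds xs : homog_seq G ds xs ->
  exists s : seq hvec, ds = map hdeg s /\ xs = map hval s.
Proof.
elim: ds xs => [|d ds IH] [|x xs] //=; first by exists [::].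
case/andP=> hx /IH[s [-> ->]].
by exists ((exist _ (d, x) hx : hvec) :: s).
Qed.

Lemma parity_sdeg (s : seq hvec) : parity (sdeg s) = odd (count hpar s).
Proof.
rewrite /sdeg; elim: s => [|h s IH]; first by rewrite big_nil.
by rewrite big_cons parityD IH /= oddD oddb.
Qed.

Lemma perm_sdeg (s t : seq hvec) : perm_eq s t -> sdeg s = sdeg t.
Proof. exact: perm_big. Qed.

Lemma has_degree_hom d K (hK : has_degree G d K) (s : seq hvec) :
  K (map hval s) \in homog G (sdeg s + d).
Proof. by have := hK _ _ (homog_seq_hom s); rewrite big_map. Qed.

(** Keeping the degree with the value lets the output of one form serve as a homogeneous argument of
    another. *)
Definition hom_image d K (hK : has_degree G d K) (s : seq hvec) : hvec :=
  exist _ (sdeg s + d, K (map hval s)) (has_degree_hom hK s).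

Lemma hpar_image d K (hK : has_degree G d K) s :
  hpar (hom_image hK s) = odd (count hpar s) (+) parity d.
Proof. by rewrite /hpar /hdeg /= parityD parity_sdeg. Qed.

Lemma insertion_hom K L (s : seq hvec) : multilinear K -> multilinear L ->
  insertion G K L (map hval s)
  = unsh hpar (fun l r => L (K (map hval l) :: map hval r)) s.
Proof.
move=> mK mL; rewrite (insertion_homog mK mL (homog_seq_hom s)).
rewrite sum_unshuffle_sum ?size_map // -map_comp zip_map unsh_map.
by apply: eq_unsh => l r _; rewrite -!map_comp.
Qed.

Lemma homog_span_ind (P : E -> Prop) :
  P 0 -> (forall (h : hvec) y, P y -> P (hval h + y)) -> forall x, P x.
Proof.
move=> P0 PD x; have [s /andP[hs /eqP ->]] := homog_span G x.
elim: s hs => [|[d y] s IH] /=; first by rewrite big_nil.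
case/andP=> hy /IH Ps; rewrite big_cons.
exact: (PD (exist _ (d, y) hy)).
Qed.

Lemma multilinear_eq0 K : multilinear K ->
  (forall s, K (map hval s) = 0) -> forall xs, K xs = 0.
Proof.
(* Arbitrary arguments are expanded one at a time into homogeneous terms, which join the prefix
   [s]. *)
move=> mK K0 xs; suff: forall s : seq hvec, K (map hval s ++ xs) = 0.
  by move/(_ [::]).
elim: xs => [|x xs IH] s; first by rewrite cats0.
elim/homog_span_ind: x => [|h y Ky].
  by apply: multilinear0 => //; rewrite mem_cat mem_head orbT.
rewrite -[hval h]scale1r mK Ky scale1r addr0.
by have := IH (rcons s h); rewrite map_rcons cat_rcons.
Qed.

Lemma multilinear_eq K L : multilinear K -> multilinear L ->
  (forall s, K (map hval s) = L (map hval s)) -> K =1 L.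
Proof.
move=> mK mL KL xs; apply/eqP; rewrite -subr_eq0 -[L xs]scale1r; apply/eqP.
apply: (multilinear_eq0 (multilinearB 1 mK mL)) => s.
by rewrite KL scale1r subrr.
Qed.

Definition hswap_symmetric K := swap_symmetric hpar (fun s => K (map hval s)).

(** One direction sorts the index word of the permutation; the other specialises to an adjacent
    transposition. *)
Lemma graded_symmetricP K : graded_symmetric G K <-> hswap_symmetric K.
Proof.
split=> [gK u v x y | sK ds xs /homog_seqP[t [-> ->]] s]; last first.
  (* Zero in degree 0 has value [0] and even parity, so it agrees with both defaults of [nth] out of
     range. *)
  pose h0 : hvec := exist _ (0, 0) (homog0 G 0).
  have nE i : nth 0 (map hval t) i = hval (nth h0 t i).
    have [it|it] := ltnP i (size t); first by rewrite (nth_map h0).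
    by rewrite !nth_default ?size_map.
  have pE i : nth false (map parity (map hdeg t)) i = hpar (nth h0 t i).
    have [it|it] := ltnP i (size t); last by rewrite !nth_default ?size_map.
    by rewrite -map_comp (nth_map h0).
  rewrite permute_map koszul_inversion_sign (eq_map nE) (map_comp hval).
  rewrite (_ : nth false _ = hpar \o nth h0 t); last exact/funext.
  have := swap_symmetric_sort (nth h0 t) [::] sK (iota_ltn_sorted 0 (size t)).
  move=> ->; last by rewrite -(size_map hval) perm_index_iota.
  by rewrite map_nth_iota0 // take_size.
pose t := u ++ y :: x :: v.
pose l := iota 0 (size u) ++ (size u).+1 :: size u :: iota (size u).+2 (size v).
have ll : perm_eq l (iota 0 (size (map hval t))).
  rewrite size_map size_cat iotaD perm_cat2l add0n /=.
  exact: (permEl (perm_catCA [:: _] [:: _] _)).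
have [s sE] := perm_index_exists ll.
have := gK _ _ (homog_seq_hom t) s.
rewrite permute_map koszul_inversion_sign sE inversion_sign_swap.
have -> : map (nth 0 (map hval t)) l = map hval (u ++ x :: y :: v).
  rewrite /l -(size_map hval u) -(size_map hval v) /t !(map_cat hval).
  exact: map_nth_swap.
move=> ->; rewrite -map_comp map_cat !nth_cat size_map !ltnNge leqnn leqnSn /=.
by rewrite subSnn subnn.
Qed.

End Homogeneous.

(** * The graded pre-Lie identity and the Richardson-Nijenhuis bracket *)

Section RichardsonNijenhuis.
Variables (F : fieldType) (E : lmodType F) (G : grading E).
Implicit Types (K L M N : vform E).
Local Notation hval := (@hval F E G).
Local Notation hpar := (@hpar F E G).

Lemma multilinearZ a x (xs : seq E) K : multilinear K ->
  K (a *: x :: xs) = a *: K (x :: xs).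
Proof.
move=> mK; rewrite -[a *: x]addr0 multilinear_head //.
by rewrite [K (0 :: _)]multilinear0 ?mem_head ?addr0.
Qed.

Lemma unsh_homog (T : eqType) (par : T -> bool) (f : seq T -> seq T -> E) d s :
  (forall l r, perm_eq (l ++ r) s -> f l r \in homog G d) ->
  unsh par f s \in homog G d.
Proof.
elim: s f => [|x s IH] f fd /=; first exact: fd.
apply: homogD; apply: IH => l r lr; first by apply: fd; rewrite /= perm_cons.
by apply: homogZ; apply: fd; rewrite -cat1s perm_catCA /= perm_cons.
Qed.

Lemma multilinear_unsh (T : Type) (par : T -> bool) (f : seq T -> seq T -> E)
    s xs M : multilinear M ->
  M (unsh par f s :: xs) = unsh par (fun l r => M (f l r :: xs)) s.
Proof.
move=> mM; elim: s f => //= x s IH f.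
rewrite -[unsh _ _ s]scale1r multilinear_head // scale1r !IH.
congr (_ + unsh _ _ _); apply/funext => l; apply/funext => r.
exact: multilinearZ.
Qed.

Lemma symform_insertion dK dL K L :
  symform G dK K -> symform G dL L -> symform G (dK + dL) (insertion G K L).
Proof.
case=> mK /graded_symmetricP sK hK [mL /graded_symmetricP sL hL].
split; first exact: multilinear_insertion.
- apply/graded_symmetricP => u v x y; rewrite !insertion_hom //.
  apply: unsh_swap_symmetric => [r|l] a b c d; first by rewrite sK multilinearZ.
  (* A swap in the right half is a swap of arguments of [L] behind the first one, [K(l)]. *)
  exact: (sL (hom_image hK l :: a)).
- move=> ds xs /homog_seqP[s [-> ->]]; rewrite insertion_hom // big_map.
  apply: unsh_homog => l r lr.
  have := has_degree_hom hL (hom_image hK l :: r).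
  congr (_ \in homog G _).
  rewrite -[\sum_(j <- s) _]/(sdeg s) -(perm_sdeg lr) /sdeg big_cons big_cat /=.
  by rewrite [X in X + _ + _]/hdeg /= -!addrA; congr (_ + _);
    rewrite addrCA [dK + _]addrC addrA.
Qed.

Lemma symformB d a K L :
  symform G d K -> symform G d L -> symform G d (fun xs => K xs - a *: L xs).
Proof.
case=> mK gK hK [mL gL hL]; split; first exact: multilinearB.
- move=> ds xs h s; rewrite (gK _ _ h) (gL _ _ h) scalerBr !scalerA.
  by rewrite [a * _]mulrC.
- move=> ds xs h; apply: homogD; first exact: hK.
  by apply: homogN; apply: homogZ; exact: hL.
Qed.

Lemma symform_RN_bracket dK dL K L : symform G dK K -> symform G dL L ->
  symform G (dK + dL) (RN_bracket G dK dL K L).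
Proof.
move=> sK sL; apply: symformB; first exact: symform_insertion.
by rewrite addrC; exact: symform_insertion.
Qed.

(* The terms of i_K (i_L M) where K and L act on disjoint sets of arguments. *)
Definition disjoint_insertion (d : int) K L M (s : seq (hvec G)) : E :=
  unsh hpar (fun a t => unsh hpar (fun b c =>
    (-1) ^+ ((odd (count hpar a) (+) parity d) && odd (count hpar b))
    *: M [:: L (map hval b), K (map hval a) & map hval c]) t) s.

(** The letter [K(a)] heads the list that is split next: it either enters [L], and coassociativity
    regroups the term, or passes [L(b)] into an argument of [M], with the sign of [K(a)] moving past
    [b]. *)
Lemma insertion_insertion dK K L M (s : seq (hvec G)) :
  has_degree G dK K -> multilinear K -> multilinear L -> multilinear M ->
  insertion G K (insertion G L M) (map hval s)
  = insertion G (insertion G K L) M (map hval s)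
    + disjoint_insertion dK K L M s.
Proof.
move=> hK mK mL mM; have mI := @multilinear_insertion F E G.
rewrite !insertion_hom //; [|exact: mI..].
transitivity (unsh hpar (fun a t =>
  unsh hpar (fun b c => M (L (K (map hval a) :: map hval b) :: map hval c)) t
  + unsh hpar (fun b c =>
    (-1) ^+ ((odd (count hpar a) (+) parity dK) && odd (count hpar b))
    *: M [:: L (map hval b), K (map hval a) & map hval c]) t) s).
  apply: eq_unsh => a t _.
  rewrite (_ : _ :: _ = map hval (hom_image hK a :: t)) //.
  by rewrite insertion_hom // /= hpar_image.
rewrite unshD -(unshA _ (fun a b c =>
  M (L (K (map hval a) :: map hval b) :: map hval c))); congr (_ + _).
by apply: eq_unsh => l c _; rewrite insertion_hom // multilinear_unsh.
Qed.

(** Cocommutativity exchanges the blocks [a] and [b], and the symmetry of [M] exchanges its first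
    two arguments; of the combined signs only that of the degrees of [K] and [L] survives. *)
Lemma disjoint_insertionC dK dL K L M (s : seq (hvec G)) :
  has_degree G dK K -> has_degree G dL L -> graded_symmetric G M ->
  disjoint_insertion dK K L M s
  = (-1) ^+ (parity dK && parity dL) *: disjoint_insertion dL L K M s.
Proof.
move=> hK hL /graded_symmetricP sM; rewrite /disjoint_insertion.
rewrite -[in RHS](unshA _ (fun a b c =>
  (-1) ^+ ((odd (count hpar a) (+) parity dL) && odd (count hpar b))
  *: M [:: K (map hval b), L (map hval a) & map hval c])).
under [in RHS]eq_unsh => l c _ do rewrite unshC.
rewrite (unshA _ (fun a b c =>
  (-1) ^+ (odd (count hpar a) && odd (count hpar b)) *:
  ((-1) ^+ ((odd (count hpar b) (+) parity dL) && odd (count hpar a))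
  *: M [:: K (map hval a), L (map hval b) & map hval c]))).
rewrite -unshZ; apply: eq_unsh => a t _; rewrite -unshZ; apply: eq_unsh => b c _.
have := sM [::] c (hom_image hK a) (hom_image hL b).
rewrite !hpar_image /= => ->; rewrite !scalerA -!signr_addb.
by do 2 case: odd; do 2 case: parity.
Qed.

(* The Jacobi identity for N of degree 0. The degree d of the inner bracket is
   arbitrary: it only enters through the sign (-1)^(0 * d). *)
Lemma RN_bracket_derivation d dL dM N L M :
  symform G 0 N -> symform G dL L -> symform G dM M ->
  (fun xs => RN_bracket G 0 d N (RN_bracket G dL dM L M) xs
    - RN_bracket G dL dM L (RN_bracket G 0 dM N M) xs)
  =1 RN_bracket G dL dM (RN_bracket G 0 dL N L) M.
Proof.
move=> [mN gN hN] [mL gL hL] [mM gM hM].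
have mI K1 K2 := @multilinear_insertion F E G K1 K2.
have mRN d1 d2 K1 K2 (m1 : multilinear K1) (m2 : multilinear K2) :
  multilinear (RN_bracket G d1 d2 K1 K2) by apply: multilinearB; exact: mI.
have -> : (fun xs => RN_bracket G 0 d N (RN_bracket G dL dM L M) xs
    - RN_bracket G dL dM L (RN_bracket G 0 dM N M) xs)
  = (fun xs => RN_bracket G 0 d N (RN_bracket G dL dM L M) xs
    - 1 *: RN_bracket G dL dM L (RN_bracket G 0 dM N M) xs).
  by apply/funext => xs; rewrite scale1r.
apply: (@multilinear_eq _ _ G) => [||s].
- by apply: multilinearB; apply: (mRN) => //; apply: mRN.
- by apply: (mRN) => //; apply: mRN.
rewrite /RN_bracket !insertionBr !insertionBl ?mI //.
rewrite !mul0r !expr0z !scale1r signz_mul.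
rewrite (insertion_insertion s hN mN mL mM) (insertion_insertion s hL mL mN mM).
rewrite (insertion_insertion s hN mN mM mL) (insertion_insertion s hM mM mN mL).
rewrite (insertion_insertion s hL mL mM mN) (insertion_insertion s hM mM mL mN).
rewrite (disjoint_insertionC s hN hL gM) (disjoint_insertionC s hN hM gL).
rewrite (disjoint_insertionC s hL hM gN) /= !scale1r.
rewrite !scalerBr !scalerDr !opprD !opprK !addrA.
(* The last three pairs cancel: the disjoint parts of [N] and [L] in [M], then the terms i_(i_N M)
   L, then i_(i_L M) N. The first six terms are the right-hand side in its own order. *)
by rewrite [LHS](ACl (1*7*12*4*6*10*(2*8)*(11*3)*(9*5)))%AC /= !subrr !addr0.
Qed.

Lemma insertion_zero K : multilinear K ->
  insertion G K (fun=> 0) = (fun=> 0) /\ insertion G (fun=> 0) K = (fun=> 0).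
Proof.
move=> mK; have zE : (fun=> 0) = (fun ys : seq E => K ys - 1 *: K ys).
  by apply/funext => ys; rewrite scale1r subrr.
split; apply/funext => xs; rewrite zE.
  by rewrite insertionBr scale1r subrr.
by rewrite insertionBl // scale1r subrr.
Qed.

(** Only the splitting with empty left half remains, and no letter passes an odd one, so there is no
    sign. This is the curvature term. *)
Lemma unshuffle_sum_0 p K L (xs : seq E) : size p = size xs ->
  unshuffle_sum 0 p K L xs = L (K [::] :: xs).
Proof.
move=> sp; rewrite unshuffle_sum_unsh //.
have unsh0 (T : eqType) (par : T -> bool) (f : seq T -> seq T -> E) s :
    (forall l r, l != [::] -> f l r = 0) -> unsh par f s = f [::] s.
  elim: s f => [|x s IH] f f0 //=.
  rewrite (eq_unsh _ (g := fun l r => 0 *: f l r)); last first.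
    by move=> l r _; rewrite f0 // scale0r.
  rewrite unshZ scale0r add0r IH; last by move=> l r l0; rewrite f0 ?scaler0.
  by rewrite /= andbF scale1r.
rewrite unsh0 => [|l r]; last by rewrite -size_eq0 => /negPf ->.
by rewrite /= -/(unzip2 _) unzip2_zip ?sp.
Qed.

(** The curved equations are the values of i_mu mu on homogeneous sequences: [k = 0] gives the
    curvature term, and the empty sequence gives l_1(l_0) = 0. *)
Lemma curved_LinftyP mu :
  curved_Linfty G mu <-> symform G 1 mu /\ insertion G mu mu = (fun=> 0).
Proof.
have insE ds xs : multilinear mu -> homog_seq G ds xs ->
    insertion G mu mu xs = mu (mu [::] :: xs)
      + \sum_(1 <= i < (size xs).+1) unshuffle_sum i (map parity ds) mu mu xs.
  move=> mm h; have := h; rewrite /homog_seq all2E => /andP[/eqP sz _].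
  rewrite (insertion_homog mm mm h) -(big_mkord xpredT (fun k =>
    unshuffle_sum k (map parity ds) mu mu xs)) big_ltn //.
  by rewrite unshuffle_sum_0 // size_map.
split=> [[smu mu0 muE]|[smu mu0]]; have [mm _ _] := smu; split=> //.
- apply/funext; apply: (@multilinear_eq0 _ _ G); first exact: multilinear_insertion.
  move=> s; rewrite (insE _ _ mm (homog_seq_hom s)).
  case: s => [|h s]; first by rewrite big_geq // addr0.
  exact: muE (homog_seq_hom _) _.
- by have := insE [::] [::] mm isT; rewrite mu0 big_geq // addr0.
- by move=> ds xs h _; rewrite -insE // mu0.
Qed.

End RichardsonNijenhuis.

(** * The hierarchy of iterated brackets with [N] *)

Section Hierarchy.
Variables (F : fieldType) (E : lmodType F) (G : grading E).
Variables (mu N K : vform E).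
Hypotheses (hmu : curved_Linfty G mu) (hN : nijenhuis G mu N K).

Local Notation mu_ k := (hierarchy G N mu k).
Local Notation br k l := (RN_bracket G 1 1 (mu_ k) (mu_ l)).

Lemma symform_hierarchy k : symform G 1 (mu_ k).
Proof.
elim: k => [|k IH]; first by case: hmu.
by case: hN => sN _ _ _; exact: (symform_RN_bracket sN IH).
Qed.

(** The base case is the Nijenhuis condition. Since [N, K] = 0, the derivation rule makes bracketing
    with [K] commute with bracketing with [N], which gives the induction step. *)
Lemma RN_bracket_square k : RN_bracket G 0 1 K (mu_ k) = mu_ k.+2.
Proof.
have [sN sK sq NK] := hN; elim: k => [|k IH]; first by apply/funext => xs /=.
have stepE j : mu_ j.+1 = RN_bracket G 0 1 N (mu_ j) by [].
rewrite [RHS]stepE -IH [in LHS]stepE.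
apply/funext => xs; have := RN_bracket_derivation 1 sN sK (symform_hierarchy k) xs.
have [mm _ _] := symform_hierarchy k.
have [z1 z2] := insertion_zero G mm.
rewrite (_ : RN_bracket G 0 0 N K = fun=> 0); last exact/funext.
rewrite [RHS]/RN_bracket z1 z2 scaler0 subrr => /eqP.
by rewrite subr_eq0 => /eqP ->.
Qed.

Lemma RN_bracket11C k l : br k l = br l k.
Proof.
apply/funext => xs; rewrite /RN_bracket mul1r expr1z !scaleN1r !opprK.
exact: addrC.
Qed.

Lemma RN_bracket11_derivation P k l : symform G 0 P -> br k l = (fun=> 0) ->
  forall xs, RN_bracket G 1 1 (RN_bracket G 0 1 P (mu_ k)) (mu_ l) xs
    = - RN_bracket G 1 1 (mu_ k) (RN_bracket G 0 1 P (mu_ l)) xs.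
Proof.
move=> sP kl xs.
rewrite -(RN_bracket_derivation 1 sP (symform_hierarchy k) (symform_hierarchy l) xs).
have [mP _ _] := sP; have [z1 z2] := insertion_zero G mP.
by rewrite kl [X in X - _]/RN_bracket z1 z2 scaler0 subrr sub0r.
Qed.

Lemma br_eq0 k l : 2 != 0 :> F -> br k l = (fun=> 0).
Proof.
move=> two0; have [sN sK _ _] := hN.
have double0 (x : E) : x = - x -> x = 0.
  move/eqP; rewrite -addr_eq0 -[x in x + _]scale1r -[x in _ + x]scale1r -scalerDl.
  by rewrite scaler_eq0 (negPf two0) => /eqP.
move: {-1}(k + l)%N (erefl (k + l)%N) => n.
elim/ltn_ind: n k l => -[|n] IH k l.
  case: k l => [|//] [|//] _; have /curved_LinftyP[_ mu0] := hmu.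
  by apply/funext => xs; rewrite /RN_bracket mu0 scaler0 subrr.
have shift i j : (i + j)%N = n.+1 ->
    forall xs, br i j xs = (-1) ^+ i *: br 0 n.+1 xs.
  elim: i j => [|i IHi] j; first by rewrite add0n => -> xs; rewrite scale1r.
  move=> ij xs; have ijn : (i + j)%N = n by case: ij.
  rewrite (RN_bracket11_derivation sN (IH n (ltnSn n) i j ijn)).
  rewrite -[RN_bracket G 0 1 N (mu_ j)]/(mu_ j.+1).
  by rewrite IHi ?addnS ?ijn // exprS mulN1r scaleNr.
suff zero : br 0 n.+1 = (fun=> 0).
  by move=> kl; apply/funext => xs; rewrite shift // zero scaler0.
apply/funext => xs; apply: double0.
(* For odd total, the symmetry of the bracket turns a(0,n+1) into a(n+1,0), and [shift] brings it
   back with sign -1. *)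
case: (boolP (odd n.+1)) => on.
  rewrite {1}RN_bracket11C (shift n.+1 0%N) ?addn0 //.
  by rewrite -signr_odd on scaleN1r.
case: n => [//|n] in IH shift on *.
(* For even total, now [n.+2], the factor mu_(n+2) is read as [K, mu_n], so that [K] can be moved
   onto mu_0, giving a(2,n). *)
rewrite -{2}(RN_bracket_square n).
rewrite -[RHS](RN_bracket11_derivation sK (IH n _ 0%N n _)) //.
by rewrite RN_bracket_square [RHS]shift // expr2 mulrNN mulr1 scale1r.
Qed.

End Hierarchy.

Lemma scalars_two_neq0 (R : realType) b : 2 != 0 :> scalars R b.
Proof. by case: b; rewrite /= Num.Theory.pnatr_eq0. Qed.

Theorem theorem2p4 (R : realType) (b : base_field)
    (E : lmodType (scalars R b)) (G : grading E) (mu N K : vform E)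
    (hmu : curved_Linfty G mu) (hN : nijenhuis G mu N K) :
  (forall k : nat, (1 <= k)%N ->
     curved_Linfty G (hierarchy G N mu k) /\
     nijenhuis G (hierarchy G N mu k) N K) /\
  (forall k l : nat, (1 <= k)%N -> (1 <= l)%N ->
     RN_bracket G 1 1 (hierarchy G N mu k) (hierarchy G N mu l) =1 (fun=> 0)).
Proof.
have two0 := scalars_two_neq0 R b.
split=> [k _|k l _ _ xs]; last by rewrite (br_eq0 hmu hN).
split.
  apply/curved_LinftyP; split; first exact: symform_hierarchy hN k.
  (* In degree 1 the bracket of mu_k with itself is twice i_(mu_k) mu_k, so its vanishing yields the
     curved equations after division by 2. *)
  apply/funext => xs; have := congr1 (@^~ xs) (br_eq0 hmu hN k k two0).
  rewrite /RN_bracket mul1r expr1z scaleN1r opprK -mulr2n -scaler_nat => /eqP.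
  by rewrite scaler_eq0 (negPf two0) => /eqP.
have [sN sK _ NK] := hN; split=> // xs.
(* The double bracket of [N] with mu_k is mu_(k+2) by definition. *)
by rewrite (RN_bracket_square hmu hN).
Qed.
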